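(* Let $(X,d)$ be a controlled metric type space with control function $\alpha : X\times X\to[1,\infty)$ such that $\sup_{x,y\in X}\alpha(x,y)$ exists (is finite) and equals $k$. Let $r\ge 0$ be a real number and let $\{x_n\}_{n\in\mathbb N}$ be an $r$-convergent sequence in $X$. Then for any cluster point $c$ of $\{x_n\}$, $LIM^{r}x_n\subseteq \overline{B}(c,rk)$.
   Context: A controlled metric type space is a nonempty set $X$ with functions $\alpha: X\times X\to[1,\infty)$ and $d:X\times X\to[0,\infty)$ such that for all $x,y,z\in X$: $d(x,y)=0$ iff $x=y$; $d(x,y)=d(y,x)$; and $d(x,y)\le \alpha(x,z)d(x,z)+\alpha(z,y)d(z,y)$. (No symmetry of $\alpha$ is assumed.) The closed ball is $\overline{B}(x,\rho)=\{y\in X: d(x,y)\le \rho\}$. For a real $r\ge0$, a sequence $\{x_n\}$ in $X$ is $r$-convergent (rough convergent of roughness degree $r$) to $x\in X$ if for every $\varepsilon>0$ there is $n_0\in\mathbb N$ with $d(x_n,x)<r+\varepsilon$ for all $n\ge n_0$; it is $r$-convergent if it is $r$-convergent to some $x\in X$. The $r$-limit set $LIM^{r}x_n$ is the set of all $x\in X$ to which $\{x_n\}$ is $r$-convergent. A point $c\in X$ is a cluster point of $\{x_n\}$ if for every $\varepsilon>0$ and every natural number $p$ there is a natural number $m>p$ with $d(x_m,c)<\varepsilon$. *)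

(* Defs.v *)
From mathcomp Require Import all_boot all_order all_algebra.
From mathcomp Require Import classical_sets reals.

Set Implicit Arguments.
Unset Strict Implicit.
Unset Printing Implicit Defensive.

Import Order.TTheory GRing.Theory Num.Theory.
Local Open Scope classical_set_scope.
Local Open Scope ring_scope.

(* [alpha] is not assumed to be symmetric. *)
Record controlled_metric_space (R : realType) (X : Type)
    (alpha d : X -> X -> R) : Prop := ControlledMetricSpace {
  cms_nonempty : [set: X] !=set0 ;
  cms_alpha_ge1 : forall x y, 1 <= alpha x y ;
  cms_ge0 : forall x y, 0 <= d x y ;
  cms_eq0 : forall x y, d x y = 0 <-> x = y ;
  cms_sym : forall x y, d x y = d y x ;
  cms_triangle : forall x y z,
    d x y <= alpha x z * d x z + alpha z y * d z y }.

Definition cms_closed_ball (R : realType) (X : Type) (d : X -> X -> R)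
    (x : X) (rho : R) : set X := [set y | d x y <= rho].

Definition rough_convergent_to (R : realType) (X : Type) (d : X -> X -> R)
    (r : R) (u : nat -> X) (x : X) : Prop :=
  forall eps : R, 0 < eps ->
    exists n0 : nat, forall n : nat, (n0 <= n)%N -> d (u n) x < r + eps.

Definition rough_convergent (R : realType) (X : Type) (d : X -> X -> R)
    (r : R) (u : nat -> X) : Prop :=
  exists x : X, rough_convergent_to d r u x.

Definition rough_lim_set (R : realType) (X : Type) (d : X -> X -> R)
    (r : R) (u : nat -> X) : set X :=
  [set x | rough_convergent_to d r u x].

Definition seq_cluster_point (R : realType) (X : Type) (d : X -> X -> R)
    (u : nat -> X) (c : X) : Prop :=
  forall eps : R, 0 < eps -> forall p : nat,
    exists2 m : nat, (p < m)%N & d (u m) c < eps.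

(* Main.v *)
(* For a cluster point c and a rough limit x, pick a term u_m that is both
   close to c and within r + e of x; the triangle inequality gives
   d(c, x) <= k e + k (r + e), and e is arbitrary. *)
Require Import Defs.
From mathcomp Require Import all_boot all_order all_algebra.
From mathcomp Require Import classical_sets reals.
From mathcomp Require Import ring.

Import Order.TTheory GRing.Theory Num.Theory.
Local Open Scope classical_set_scope.
Local Open Scope ring_scope.

(** The supremum [k] bounds both weights of the controlled triangle inequality, whatever term [u m]
    is interpolated, so the bound on [d c x] is uniform in [m] and the excess over [r * k] shrinks
    with [e]. *)

Theorem theorem3p15 (R : realType) (X : Type) (alpha d : X -> X -> R)
    (Xcms : controlled_metric_space alpha d)
    (k : R)
    (alpha_has_sup : has_sup [set alpha p.1 p.2 | p in [set: X * X]])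
    (alpha_sup : sup [set alpha p.1 p.2 | p in [set: X * X]] = k)
    (r : R) (r_ge0 : 0 <= r)
    (u : nat -> X) (u_rcvg : rough_convergent d r u)
    (c : X) (c_cluster : seq_cluster_point d u c) :
  rough_lim_set d r u `<=` cms_closed_ball d c (r * k).
Proof.
move=> x u_x; rewrite /cms_closed_ball /=.
have alpha_le y z : alpha y z <= k.
  by rewrite -alpha_sup; apply: ub_le_sup; [case: alpha_has_sup | exists (y, z)].
have k_gt0 : 0 < k.
  exact: lt_le_trans ltr01 (le_trans (cms_alpha_ge1 Xcms c c) (alpha_le c c)).
have alpha_ge0 y z : 0 <= alpha y z := le_trans ler01 (cms_alpha_ge1 Xcms y z).
apply/ler_addgt0Pr => eps eps_gt0.
(* The two estimates together exceed [r * k] by [2 * k * e], which this choice makes exactly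
   [eps]. *)
pose e := eps / (2 * k).
have e_gt0 : 0 < e by rewrite divr_gt0 // mulr_gt0.
have [n0 u_near_x] := u_x e e_gt0.
(* Searching beyond [n0] makes one term serve both estimates. *)
have [m n0_lt_m um_near_c] := c_cluster e e_gt0 n0.
have -> : r * k + eps = k * e + k * (r + e).
  by rewrite /e; field; rewrite gt_eqF.
apply: le_trans (cms_triangle Xcms c x (u m)) _.
apply: lerD; apply: ler_pM => //; try exact: cms_ge0 Xcms _ _.
- by rewrite (cms_sym Xcms) ltW.
- exact/ltW/u_near_x/ltnW.
Qed.
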